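(* Let $C$ be a linear (first order) continuous diffusion process on $G$ and let $D$ be a discrete version of $C$ with an arbitrary rounding scheme, both started from the same initial load vector $x^D(0)=x^C(0)$. Then for every node $k$ and every round $t\ge 0$, $$x^D_k(t)-x^C_k(t)=\sum_{s=1}^{t}\ \sum_{\{i,j\}\in E} e_{i,j}(t-s)\;\mathcal{C}^{C}_{k,i\rightarrow j}(s-1).$$
   Context: $G=(V,E)$ is a finite undirected graph, $V=\{1,\dots,n\}$, $N(i)$ the neighbors of $i$. A (first order) diffusion process $A$ is a map from load vectors $\mathbf{x}\in\mathbb{R}^n$ to flow matrices $A(\mathbf{x})\in\mathbb{R}^{n\times n}$ that are antisymmetric (load conservation over each edge) and vanish at pairs $(i,j)$ that are not edges. It runs as follows: $y^A(t)=A(x^A(t))$, where $y^A_{i,j}(t)$ is the load sent from $i$ to $j$ in round $t$, and $x^A_i(t+1)=x^A_i(t)-\sum_{j\in N(i)}y^A_{i,j}(t)$; $x^A_i(t)$ is the load of node $i$ at the beginning of round $t$. $A$ is linear if $A(a\mathbf{x}+b\mathbf{x}')=aA(\mathbf{x})+bA(\mathbf{x}')$ for all $\mathbf{x},\mathbf{x}'\in\mathbb{R}^n$, $a,b\in\mathbb{R}$. A process $D$ is a discrete version of $C$ with rounding scheme $R_D$ if $D(\mathbf{x})=R_D(C(\mathbf{x}))$ for every $\mathbf{x}$, where $R_D$ is a function that rounds each entry of the flow matrix to an integer (keeping antisymmetry and zero entries at non-edges). The rounding error is $e_{i,j}(t)=\hat Y_{i,j}(t)-y^D_{i,j}(t)$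 where $\hat Y(t)=C(x^D(t))$; note $e_{i,j}(t)=-e_{j,i}(t)$. The contribution of edge $(i,j)$ on node $k$ after $t$ rounds is $\mathcal{C}^{C}_{k,i\rightarrow j}(t)=\mathbf{x}_k-\mathbf{x}'_k$, where $\mathbf{x}$ and $\mathbf{x}'$ are the load vectors obtained by applying $C$ for $t$ rounds starting from the unit vectors $\hat{\mathbf{i}}$ and $\hat{\mathbf{j}}$, respectively (so at $t=0$ they are $\hat{\mathbf i},\hat{\mathbf j}$). Each summand is independent of the orientation chosen for the edge $\{i,j\}$. *)

(* Defs.v *)
From mathcomp Require Import all_boot all_order all_algebra.
From mathcomp Require Import reals.
Set Implicit Arguments.
Unset Strict Implicit.
Unset Printing Implicit Defensive.
Import Order.TTheory GRing.Theory Num.Theory.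
Local Open Scope ring_scope.

Record sgraph (n : nat) := SGraph {
  edge :> rel 'I_n;
  edge_sym : symmetric edge;
  edge_irrefl : irreflexive edge
}.

(* An undirected edge {i, j} is represented once, by its pair with i < j. *)
Definition edges (n : nat) (G : sgraph n) : {set 'I_n * 'I_n} :=
  [set p : 'I_n * 'I_n | G p.1 p.2 && (p.1 < p.2)%N].

Section Diffusion.
Variables (R : realType) (n : nat) (G : sgraph n).
Implicit Types (A C D : 'rV[R]_n -> 'M[R]_n) (x : 'rV[R]_n) (Y : 'M[R]_n).
Implicit Types (i j k : 'I_n) (t : nat).

Definition flow_matrix Y : Prop :=
  (forall i j, Y i j = - Y j i) /\ (forall i j, ~~ G i j -> Y i j = 0).

Definition diffusion_process A : Prop := forall x, flow_matrix (A x).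

(* The rounding may depend on the whole flow matrix, and no bound on the
   distance between an entry and its rounded value is imposed. *)
Definition rounding_scheme (RD : 'M[R]_n -> 'M[R]_n) : Prop :=
  forall Y, flow_matrix Y ->
    flow_matrix (RD Y) /\ (forall i j, RD Y i j \is a Num.int).

Definition discrete_version C (RD : 'M[R]_n -> 'M[R]_n) D : Prop :=
  forall x, D x = RD (C x).

Definition step A x : 'rV[R]_n :=
  \row_i (x 0 i - \sum_(j | G i j) A x i j).

Definition load A x t : 'rV[R]_n := iter t (step A) x.

Definition flow A x t : 'M[R]_n := A (load A x t).

Definition rounding_error C D x t : 'M[R]_n :=
  C (load D x t) - flow D x t.

Definition contribution C k i j t : R :=
  load C (delta_mx 0 i) t 0 k - load C (delta_mx 0 j) t 0 k.

(* The orientation i < j chosen in [edges] is immaterial for such summands. *)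
Lemma error_contribution_swap C D RD x k i j t t' :
  diffusion_process C -> rounding_scheme RD -> discrete_version C RD D ->
  rounding_error C D x t i j * contribution C k i j t' =
  rounding_error C D x t j i * contribution C k j i t'.
Proof.
move=> HC HR HD; rewrite /rounding_error /flow HD.
set z := load D x t.
have [HCz _] := HC z; have [[HRz _] _] := HR _ (HC z).
rewrite !mxE HCz HRz -opprD mulNr -mulrN.
by rewrite /contribution opprB.
Qed.

End Diffusion.

(* Main.v *)
(* Replaying the discrete run up to round t - s and then C for s rounds
   interpolates between the two loads as s goes from 0 to t.  Two consecutive
   interpolants differ by the image, under s - 1 rounds of C, of the error
   committed in round t - s; and by antisymmetry that error is a combination,
   over the edges {i, j}, of the vectors e_i - e_j. *)
Require Import Defs.
From mathcomp Require Import all_boot all_order all_algebra.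
From mathcomp Require Import reals.
Import Order.TTheory GRing.Theory Num.Theory.
Local Open Scope ring_scope.

Lemma linear_subr (R : pzRingType) (U V : lmodType R) (f : U -> V) (u v : U) :
  linear f -> f (u - v) = f u - f v.
Proof. by move=> lin_f; rewrite addrC -scaleN1r lin_f scaleN1r addrC. Qed.

Lemma linear_sumB (R : pzRingType) (U V : lmodType R) (f : U -> V)
    (I : finType) (P : pred I) (a : I -> R) (u v : I -> U) :
  linear f ->
  f (\sum_(p | P p) a p *: (u p - v p)) =
  \sum_(p | P p) a p *: (f (u p) - f (v p)).
Proof.
move=> lin_f; elim/big_rec2: _ => [|p y x _ <-].
  (* The empty sum requires [f 0 = 0], obtained by reading [0] as [0 - 0]. *)
  by rewrite -[in LHS](subrr 0) linear_subr // subrr.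
by rewrite lin_f linear_subr.
Qed.

Lemma step_linear (R : realType) (n : nat) (G : sgraph n)
    (C : 'rV[R]_n -> 'M[R]_n) :
  linear C -> linear (step G C).
Proof.
move=> lin_C a u v; apply/rowP => i; rewrite !mxE lin_C.
under eq_bigr do rewrite !mxE.
by rewrite big_split -mulr_sumr /= mulrBr opprD addrACA.
Qed.

Lemma load_linear (R : realType) (n : nat) (G : sgraph n)
    (C : 'rV[R]_n -> 'M[R]_n) (t : nat) :
  linear C -> linear (fun x => load G C x t).
Proof.
move=> lin_C a u v; elim: t => //= t IHt.
by rewrite [LHS](congr1 (step G C) IHt) step_linear.
Qed.

(** An edge with ends a < b sends [E a b] out of a and, by antisymmetry, [- E a b] out of b: this is
    [E a b] times the difference of the two unit vectors. *)
Lemma net_outflow_edges (R : pzRingType) (n : nat) (G : sgraph n)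
    (E : 'M[R]_n) :
  (forall i j, E i j = - E j i) ->
  \row_i (\sum_(j | G i j) E i j) =
  \sum_(p in edges G) E p.1 p.2 *: (delta_mx 0 p.1 - delta_mx 0 p.2) :> 'rV_n.
Proof.
move=> antiE; apply/rowP => i; rewrite !mxE summxE.
(* Cutting [E] down to a < b makes the edge sum a full double sum, in which each unit vector
   collapses one index. *)
pose e a b : R := if G a b && (a < b)%N then E a b else 0.
transitivity (\sum_a \sum_b e a b * ((i == a)%:R - (i == b)%:R)); last first.
  rewrite pair_big [RHS]big_mkcond; apply: eq_bigr => -[a b] _ /=.
  by rewrite inE /e /= !mxE !eqxx /=; case: ifP => // _; rewrite mul0r.
under [RHS]eq_bigr => a _ do
  (under eq_bigr => b _ do rewrite mulrBr; rewrite sumrB).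
rewrite sumrB [X in _ = _ - X]exchange_big /=.
rewrite [X in _ = X - _](bigD1 i) //= [X in _ = _ + X - _]big1; last first.
  by move=> a /negPf ia; rewrite big1 // => b _; rewrite eq_sym ia mulr0.
rewrite [X in _ = _ - X](bigD1 i) //= [X in _ = _ - (_ + X)]big1; last first.
  by move=> a /negPf ia; rewrite big1 // => b _; rewrite eq_sym ia mulr0.
rewrite !addr0 -sumrB big_mkcond; apply: eq_bigr => j _.
(* What remains is [e i j - e j i], where at most one term survives; for j < i, antisymmetry turns
   [- E j i] into [E i j]. *)
rewrite eqxx !mulr1 /e (edge_sym G j i).
case: (boolP (G i j)) => //= Gij; last by rewrite subr0.
case: ltngtP => [_|_|/val_inj ij]; rewrite ?subr0 ?sub0r //.
by rewrite ij edge_irrefl in Gij.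
Qed.

Lemma step_discrete_error (R : realType) (n : nat) (G : sgraph n)
    (C D : 'rV[R]_n -> 'M[R]_n) (x : 'rV[R]_n) :
  step G D x - step G C x = \row_i (\sum_(j | G i j) (C x - D x) i j).
Proof.
apply/rowP => i; rewrite !mxE.
under [RHS]eq_bigr do rewrite !mxE.
by rewrite sumrB opprB addrC addrA subrK.
Qed.

Theorem lemma2 (R : realType) (n : nat) (G : sgraph n)
    (C D : 'rV[R]_n -> 'M[R]_n) (RD : 'M[R]_n -> 'M[R]_n) (x0 : 'rV[R]_n)
    (C_process : diffusion_process G C) (C_linear : linear C)
    (RD_rounding : rounding_scheme G RD)
    (D_discrete : discrete_version C RD D)
    (k : 'I_n) (t : nat) :
  load G D x0 t 0 k - load G C x0 t 0 k =
  \sum_(1 <= s < t.+1) \sum_(p in edges G)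
    rounding_error G C D x0 (t - s) p.1 p.2 *
    contribution G C k p.1 p.2 s.-1.
Proof.
pose a s := load G C (load G D x0 (t - s)) s 0 k.
have -> : load G D x0 t 0 k - load G C x0 t 0 k = - (a t - a 0%N).
  by rewrite opprB /a subn0 subnn.
rewrite -(telescope_sumr a (leq0n t)) -sumrN big_add1 /=.
rewrite !big_mkord; apply: eq_bigr => -[s lt_st] _ /=; rewrite opprB /a.
set z := load G D x0 (t - s.+1).
(* As s < t, the truncated subtraction loses nothing: [t - s] is the successor of [t - s.+1]. *)
have -> : load G D x0 (t - s) = step G D z by rewrite -(subnSK lt_st).
(* Peeling off the first round of [C], not the last, leaves both interpolants as [s] rounds of [C],
   from [step G D z] and [step G C z]. *)
have -> : load G C z s.+1 = load G C (step G C z) s by rewrite /load iterSr.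
have antiE i j : (C z - D z) i j = - (C z - D z) j i.
  have [antiC _] := C_process z; have [[antiR _] _] := RD_rounding _ (C_process z).
  by rewrite D_discrete !mxE antiC antiR opprD.
pose f x := load G C x s.
have lin_f : linear f by apply: load_linear.
rewrite -!/(f _).
(* The left side, expanded over the edges, becomes the round's summand; [f] at the unit vectors
   yields the contributions. *)
have /rowP/(_ k) := linear_subr _ _ _ f (step G D z) (step G C z) lin_f.
rewrite step_discrete_error net_outflow_edges // linear_sumB //.
rewrite summxE !mxE => <-.
by apply: eq_bigr => p _; rewrite !mxE.
Qed.
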